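(* Let $m\ge 1$ be an integer, let $c<d$ be real numbers, and let $b,b'>0$ be such that $(d-c)/b$ and $(d-c)/b'$ are integers and $d-c\ge mb$. Let $\Delta=\mathcal{P}_b[c,d]$ and $\Delta'=\mathcal{P}_{b'}[c,d]$ be the equidistant partitions of $[c,d]$ with spacings $b$ and $b'$, and suppose that $\Delta\subset\Delta'$. Let $\phi(x)=\frac1b B\left(\frac xb\right)$, where $B$ is the cardinal B-spline of order $m$ with knots $0,1,\dots,m$, and for real $k$ let $\phi_k$ be the restriction to $[c,d]$ of $x\mapsto\phi(x-k)$. Define the dictionary $$\mathcal{D}_m(\Delta,b')=\{\phi_k\}_{k\in\mathcal{P}_{b'}(c-mb,d)}.$$ Then $$\operatorname{span}\{\mathcal{D}_m(\Delta,b')\}=S_m(\Delta').$$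
   Context: Partitions. A partition of $[c,d]$ is a finite set $\Delta=\{x_i\}_{i=0}^{N+1}$, $N\in\mathbb{N}=\{1,2,\dots\}$, with $c=x_0<x_1<\dots<x_N<x_{N+1}=d$. Put $I_i=[x_i,x_{i+1})$ for $i=0,\dots,N-1$ and $I_N=[x_N,x_{N+1}]$. For real $s<t$ and $h>0$ with $(t-s)/h$ an integer, $\mathcal{P}_h[s,t]=\{s,s+h,\dots,t-h,t\}$ and $\mathcal{P}_h(s,t)=\{s+h,\dots,t-h\}$. (Both $\Delta=\mathcal{P}_b[c,d]$ and $\Delta'=\mathcal{P}_{b'}[c,d]$ are taken to be partitions of $[c,d]$, that is, finite sets of the form $\{x_i\}_{i=0}^{N+1}$ with $N\ge1$ and $c=x_0<x_1<\dots<x_{N+1}=d$. If $\Delta\subset\Delta'$ then $b/b'$ is a positive integer, so $\mathcal{P}_{b'}(c-mb,d)$ is well defined.) Spline space. With $\Pi_{m-1}$ the space of real polynomials of degree at most $m-1$, $$S_m(\Delta)=\{f\in C^{m-2}[c,d] : f|_{I_i}\in\Pi_{m-1},\ i=0,\dots,N\},$$ the space of splines of order $m$ with simple knots at $x_1,\dots,x_N$. For $m=1$ there is no continuity condition, i.e. $S_1(\Delta)$ consists of functions that are constant on each $I_i$. Cardinal B-spline of order $m$: $$B(x)=\frac{1}{m!}\sum_{i=0}^m(-1)^i\binom{m}{i}(x-i)_+^{m-1},$$ where $(x-i)_+^{m-1}=(x-i)^{m-1}$ if $x-i>0$ and $0$ otherwise. The function $\phi(x)=\frac1b B(x/b)$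 has support $[0,mb]$. Convention for $m=1$: functions on $[c,d]$ that agree except at finitely many points are identified (so the values of piecewise constant functions at knots and endpoints are disregarded). For $m\ge2$ all functions are continuous and no identification is needed. The span is the real linear span of functions on $[c,d]$. *)

(* Defs.v *)
From HB Require Import structures.
From mathcomp Require Export all_boot all_order all_algebra.
From mathcomp Require Export all_classical all_reals all_analysis.

Set Implicit Arguments.
Unset Strict Implicit.
Unset Printing Implicit Defensive.

Export Order.TTheory GRing.Theory Num.Theory.
Export numFieldNormedType.Exports.

#[export] Set Implicit Arguments.
#[export] Unset Strict Implicit.
#[export] Unset Printing Implicit Defensive.

Local Open Scope classical_set_scope.
Local Open Scope ring_scope.

(* Finite subsets of R are given by their increasing enumeration, so that
   the knot x_i of a partition xs is [nth 0 xs i]. A real function on [c, d]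
   is given by a function on R whose values outside [c, d] are disregarded:
   see [same_on] and [classes_on]. *)

Section Partitions.
Variable R : realType.
Implicit Types (c d h s t : R) (xs : seq R).

(* N >= 1 interior knots, hence at least three points in all *)
Definition is_partition c d xs : bool :=
  [&& (3 <= size xs)%N, sorted <%R xs, head 0 xs == c & last 0 xs == d].

(* I_i, right-closed only for the last index i = N, where size xs = N + 2 *)
Definition cell xs (i : nat) : set R :=
  if (i.+2 < size xs)%N then [set` `[nth 0 xs i, nth 0 xs i.+1[]
  else [set` `[nth 0 xs i, nth 0 xs i.+1]].

(* {s, s + h, ..., t} and {s + h, ..., t - h}; meaningful when s < t, 0 < h
   and (t - s) / h is an integer, which truncn then returns exactly *)
Definition grid h s t : seq R :=
  [seq s + i%:R * h | i <- iota 0 (Num.truncn ((t - s) / h)).+1].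

Definition open_grid h s t : seq R :=
  [seq s + i%:R * h | i <- iota 1 (Num.truncn ((t - s) / h)).-1].

End Partitions.

Section Splines.
Variable R : realType.
Implicit Types (c d : R) (f g : R -> R) (A : set R) (m : nat).

(* f has derivative l at x relative to A (one-sided at the endpoints when A
   is a closed interval) *)
Definition has_deriv_within A f (x l : R) : Prop :=
  (f y - f x) / (y - x) @[y --> within A x^'] --> l.

(* f is of class C^k on A *)
Fixpoint Ck (k : nat) A f : Prop :=
  match k with
  | 0 => {within A, continuous f}
  | k'.+1 => exists2 f' : R -> R,
      (forall x, A x -> has_deriv_within A f x (f' x)) & Ck k' A f'
  end.

(* S_m(xs); for m = 1 there is no smoothness condition *)
Definition spline_space m c d (xs : seq R) : set (R -> R) :=
  [set f | ((2 <= m)%N -> Ck (m - 2) [set` `[c, d]] f) /\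
     (forall i, (i.+1 < size xs)%N ->
        exists2 p : {poly R}, (size p <= m)%N &
          forall x, cell xs i x -> f x = p.[x])].

(* Identification of functions on A: up to finitely many points for m = 1 *)
Definition same_on m A f g : Prop :=
  if m == 1%N then finite_set [set x | A x /\ f x <> g x]
  else forall x, A x -> f x = g x.

(* The set F of functions on [c, d], as a union of classes for [same_on]:
   F and G are the same set of (identified) functions on [c, d] if and only
   if [classes_on m c d F = classes_on m c d G] *)
Definition classes_on m c d (F : set (R -> R)) : set (R -> R) :=
  [set f | exists2 g, F g & same_on m [set` `[c, d]] f g].

Definition lin_span (D : set (R -> R)) : set (R -> R) :=
  [set f | exists n (a : 'I_n -> R) (v : 'I_n -> R -> R),
     (forall i, D (v i)) /\ f = (fun x => \sum_(i < n) a i * v i x)].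

(* x_+^k, with x_+^0 = 0 for x <= 0 *)
Definition pos_pow (x : R) (k : nat) : R := if 0 < x then x ^+ k else 0.

(* Note the normalisation 1 / m! rather than 1 / (m - 1)! *)
Definition Bspline m (x : R) : R :=
  (m`!%:R)^-1 *
  \sum_(0 <= i < m.+1) (-1) ^+ i * 'C(m, i)%:R * pos_pow (x - i%:R) m.-1.

Definition phi m (b x : R) : R := b^-1 * Bspline m (x / b).

Definition dictionary m c d (b b' : R) : set (R -> R) :=
  [set (fun x => phi m b (x - k)) | k in [set` open_grid b' (c - m%:R * b) d]].

End Splines.

(* Main.v *)
(** Write [h_y(x) = (x - y)_+^(m-1)] and [y_t = c - m b + t b'], so that the
knots of the fine grid are [y_(mq), ..., y_(mq+n) = d], where [b = q b']. Up to
a nonzero factor, [phi (x - y_t)] is [h_(y_t)] plus a combination of the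
[h_(y_(t+iq))] with [1 <= i <= m], and [h_y] vanishes on [[c, d]] for
[y >= d]. By downward induction on [t] the dictionary therefore spans all
[h_(y_t)] with [t >= 1]. These span the splines: the jump of a
spline across a knot [y] is a multiple of [(x - y)^(m-1)], so a spline is its
first polynomial piece plus truncated powers at the interior knots, and [m]
distinct shifts [(x - y_(mq-j))^(m-1)], [0 <= j < m], span the polynomials of
degree less than [m] by a Vandermonde determinant. *)

Require Import Defs.
From mathcomp Require Import all_boot all_order all_algebra.
From mathcomp Require Import all_classical all_reals all_analysis.
From mathcomp Require Import ring zify.
Local Open Scope classical_set_scope.
Local Open Scope ring_scope.

(** * Difference quotients and derivatives relative to a set *)

Lemma has_deriv_within_dnbhs (R : realType) (A : set R) (f : R -> R) (x l : R) :
  (f y - f x) / (y - x) @[y --> x^'] --> l -> has_deriv_within A f x l.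
Proof. by apply: cvg_trans; apply: cvg_app; exact: cvg_within. Qed.

(** At an interior point, [A] contains a punctured neighbourhood, so restricting the limit to [A]
    changes nothing. *)
Lemma has_deriv_dnbhs (R : realType) (A : set R) (f : R -> R) (x l : R) :
  nbhs x A -> has_deriv_within A f x l ->
  (f y - f x) / (y - x) @[y --> x^'] --> l.
Proof.
move=> nA; apply: cvg_trans; apply: cvg_app => B hB.
have hAB : \forall y \near x^', A y -> B y by [].
have hA : \forall y \near x^', A y by exact: nbhs_dnbhs.
by near=> y; apply: (near hAB y) => //; apply: (near hA y).
Unshelve. all: by end_near. Qed.

Lemma dnbhs_quotient_near_eq (R : realType) (f g : R -> R) (x l : R) :
  (\forall y \near x, f y = g y) ->
  (g y - g x) / (y - x) @[y --> x^'] --> l ->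
  (f y - f x) / (y - x) @[y --> x^'] --> l.
Proof.
move=> fg; apply: cvg_trans; apply: near_eq_cvg.
have fx := nbhs_singleton fg; have fg' := nbhs_dnbhs fg.
by near=> y; rewrite fx (near fg' y).
Unshelve. all: by end_near. Qed.

(** Factor [p - p.[x]%:P] as [s * ('X - x%:P)]: away from [x] the quotient is [s], and
    differentiating the factorisation shows that [s.[x]] is the derivative of [p] at [x]. *)
Lemma dnbhs_quotient_horner (R : realType) (p : {poly R}) (x : R) :
  (p.[y] - p.[x]) / (y - x) @[y --> x^'] --> p^`().[x].
Proof.
have : root (p - p.[x]%:P) x by rewrite /root !hornerE subrr.
move/factor_theorem => [s sE].
have -> : p^`().[x] = s.[x].
  have := congr1 (fun q : {poly R} => q^`().[x]) sE.
  by rewrite /= derivB derivC subr0 derivM derivXsubC !hornerE subrr mulr0 add0r.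
have : s.[y] @[y --> x^'] --> s.[x].
  apply: cvg_trans (@continuous_horner _ s x).
  by apply: cvg_app; exact: nbhs_dnbhs.
apply: cvg_trans; apply: near_eq_cvg.
have yx := nbhs_dnbhs_neq x.
near=> y.
have : p.[y] - p.[x] = s.[y] * (y - x).
  by have := congr1 (fun q : {poly R} => q.[y]) sE; rewrite /= !hornerE.
by move=> ->; rewrite mulfK // subr_eq0; exact: (near yx y).
Unshelve. all: by end_near. Qed.

(** * Truncated powers and their derivatives *)

Lemma pos_powS (R : realType) (x : R) k : pos_pow x k.+1 = x * pos_pow x k.
Proof. by rewrite /pos_pow exprS; case: ifP => _; rewrite ?mulr0. Qed.

Lemma pos_powE (R : realType) (x : R) k : pos_pow x k.+1 = (Num.max x 0) ^+ k.+1.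
Proof.
rewrite /pos_pow; case: ifPn => [x0|]; first by rewrite max_l // ltW.
by rewrite -leNgt => x0; rewrite max_r // expr0n.
Qed.

Lemma pos_powMl (R : realType) (a x : R) k :
  0 < a -> pos_pow (a * x) k = a ^+ k * pos_pow x k.
Proof.
by move=> a0; rewrite /pos_pow pmulr_rgt0 // exprMn; case: ifP; rewrite ?mulr0.
Qed.

Lemma continuous_pos_pow (R : realType) k : continuous (fun x : R => pos_pow x k.+1).
Proof.
move=> x; rewrite (_ : (fun x => _) = (fun x => (Num.max x 0) ^+ k.+1)); last first.
  by apply/funext => y; rewrite pos_powE.
have c1 : {for x, continuous ((fun y : R => y : R^o) \max (fun=> 0))}.
  by apply: continuous_max; [exact: cvg_id|exact: cvg_cst].
exact: (continuous_comp c1 (@exprn_continuous R k.+1 (Num.max x 0))).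
Qed.

Lemma continuous_pos_pow_shift (R : realType) (a : R) k :
  continuous (fun x : R => pos_pow (x - a) k.+1).
Proof.
move=> x; have c1 : {for x, continuous (fun y => y - a)}.
  by apply: continuousB; [exact: cvg_id|exact: cvg_cst].
exact: (continuous_comp c1 (@continuous_pos_pow R k (x - a))).
Qed.

(** Off [a] the function is locally a polynomial; at [a] the quotient is itself the truncated power
    of one degree less, which tends to 0. *)
Lemma dnbhs_quotient_pos_pow (R : realType) (a x : R) k :
  (pos_pow (y - a) k.+2 - pos_pow (x - a) k.+2) / (y - x) @[y --> x^'] -->
  k.+2%:R * pos_pow (x - a) k.+1.
Proof.
have [xa|ax|<-] := ltgtP x a.
- rewrite [X in _ * X]/pos_pow subr_gt0 ltNge (ltW xa) mulr0.
  have -> : (0 : R) = (0 : {poly R})^`().[x] by rewrite deriv0 horner0.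
  apply: (@dnbhs_quotient_near_eq _ _ (fun y => (0 : {poly R}).[y])); last first.
    exact: dnbhs_quotient_horner.
  have ya := lt_nbhsl xa.
  near=> y; rewrite /pos_pow subr_gt0 horner0 ltNge ltW //; exact: (near ya y).
- rewrite [X in _ * X]/pos_pow subr_gt0 ax.
  have -> : k.+2%:R * (x - a) ^+ k.+1 = (('X - a%:P) ^+ k.+2)^`().[x].
    by rewrite deriv_exp derivXsubC mul1r hornerMn horner_exp hornerXsubC mulr_natl.
  apply: (@dnbhs_quotient_near_eq _ _ (fun y => (('X - a%:P) ^+ k.+2).[y])); last first.
    exact: dnbhs_quotient_horner.
  have ay := lt_nbhsr ax.
  by near=> y; rewrite /pos_pow subr_gt0 !hornerE ifT //; exact: (near ay y).
- rewrite subrr [X in _ * X]/pos_pow ltxx mulr0.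
  have : pos_pow (y - x) k.+1 @[y --> x^'] --> (0 : R).
    have -> : (0 : R) = pos_pow (x - x) k.+1 by rewrite /pos_pow subrr ltxx.
    apply: cvg_trans (@continuous_pos_pow_shift _ x k x).
    by apply: cvg_app; exact: nbhs_dnbhs.
  apply: cvg_trans; apply: near_eq_cvg.
  have yx := nbhs_dnbhs_neq x.
  near=> y.
  rewrite [pos_pow (_ - _) k.+2]pos_powS [pos_pow 0 _]/pos_pow ltxx subr0 mulrAC.
  by rewrite mulfV ?mul1r // subr_eq0; exact: (near yx y).
Unshelve. all: by end_near. Qed.

(** * Functions of class $C^k$ and their polynomial pieces *)

Lemma has_deriv_withinDZ (R : realType) (A : set R) (a : R) (f g : R -> R) (x lf lg : R) :
  has_deriv_within A f x lf -> has_deriv_within A g x lg ->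
  has_deriv_within A (fun y => a * f y + g y) x (a * lf + lg).
Proof.
move=> hf hg; rewrite /has_deriv_within.
apply: cvg_trans (cvgD (cvgMl_tmp (a := a) hf) hg).
apply: near_eq_cvg; apply: nearW => y; rewrite fctE.
by rewrite opprD addrACA -mulrBr [RHS]mulrDl mulrA.
Qed.

Lemma CkDZ (R : realType) k (A : set R) (a : R) (f g : R -> R) :
  Ck k A f -> Ck k A g -> Ck k A (fun x => a * f x + g x).
Proof.
elim: k f g => [|k IH] f g /=.
  move=> /subspace_continuousP cf /subspace_continuousP cg.
  apply/subspace_continuousP => x Ax.
  exact: cvgD (cvgMl_tmp (a := a) (cf x Ax)) (cg x Ax).
move=> [f' df cf] [g' dg cg]; exists (fun x => a * f' x + g' x); last exact: IH.
by move=> x Ax; apply: has_deriv_withinDZ; [exact: df|exact: dg].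
Qed.

Lemma Ck_cst0 (R : realType) k (A : set R) : Ck k A (fun=> 0).
Proof.
elim: k => [|k IH] /=.
  by apply/subspace_continuousP => x Ax; exact: cvg_cst.
exists (fun=> 0) => // x Ax; apply: has_deriv_within_dnbhs.
have : (0 : R) @[y --> x^'] --> (0 : R) by exact: cvg_cst.
by apply: cvg_trans; apply: near_eq_cvg; apply: nearW => y /=; rewrite subrr mul0r.
Qed.

Lemma Ck_pos_pow (R : realType) k (A : set R) (a : R) :
  Ck k A (fun x => pos_pow (x - a) k.+1).
Proof.
elim: k => [|k IH] /=.
  apply/subspace_continuousP => x Ax.
  apply: cvg_trans (@continuous_pos_pow_shift _ a 0 x).
  by apply: cvg_app; exact: cvg_within.
exists (fun x => k.+2%:R * pos_pow (x - a) k.+1 + 0).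
  move=> x Ax; apply: has_deriv_within_dnbhs; rewrite addr0.
  exact: dnbhs_quotient_pos_pow.
by apply: CkDZ => //; exact: Ck_cst0.
Qed.

Lemma Ck_cvg (R : realType) k (A : set R) (f : R -> R) (y : R) :
  nbhs y A -> Ck k A f -> f x @[x --> y^'] --> f y.
Proof.
move=> nA; case: k => [|k] /=.
  move=> /subspace_continuousP /(_ y (nbhs_singleton nA)).
  apply: cvg_trans; apply: cvg_app => B hB.
  have hAB : \forall z \near y, A z -> B z by [].
  have h : \forall z \near y, B z by near=> z; apply: (near hAB z) => //; exact: (near nA z).
  exact: (nbhs_dnbhs h).
move=> [f' df _].
have q : (f z - f y) / (z - y) @[z --> y^'] --> f' y.
  exact: has_deriv_dnbhs nA (df _ (nbhs_singleton nA)).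
have i : z - y @[z --> y^'] --> y - y.
  by apply: cvgB; [exact: nbhs_dnbhs|exact: cvg_cst].
have lim : (f z - f y) / (z - y) * (z - y) + f y @[z --> y^'] --> f y.
  rewrite -[X in _ --> X]add0r -(mulr0 (f' y)) -(subrr y).
  exact: cvgD (cvgM q i) (cvg_cst (f y)).
apply: cvg_trans lim; apply: near_eq_cvg.
have zy := nbhs_dnbhs_neq y.
near=> z; rewrite divfK ?subrK // subr_eq0; exact: (near zy z).
Unshelve. all: by end_near. Qed.

(** Induction on [k]: both pieces take the value [f y] at [y] as one-sided limits, and the
    derivative of [f] has as pieces the derivatives of [p] and [q]. *)
Lemma Ck_jump (R : realType) k (A : set R) (f : R -> R) (p q : {poly R}) (u y v : R) :
  u < y -> y < v -> (forall x, u < x -> x < v -> A x) -> Ck k A f ->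
  (forall x, u < x -> x < y -> f x = p.[x]) ->
  (forall x, y < x -> x < v -> f x = q.[x]) ->
  forall j, (j <= k)%N -> p^`(j).[y] = q^`(j).[y].
Proof.
move=> uy yv uvA.
have nA x : u < x -> x < v -> nbhs x A.
  move=> ux xv; have h1 := lt_nbhsr ux; have h2 := lt_nbhsl xv.
  by near=> z; apply: uvA; [exact: (near h1 z)|exact: (near h2 z)].
(* Agreement on one side of [z] suffices, by one-sided limits; the left case serves [p] and the
   right case serves [q]. *)
have limit_value k' g r : Ck k' A g -> forall z, u < z -> z < v ->
    (forall x, u < x -> x < z -> g x = r.[x]) \/
    (forall x, z < x -> x < v -> g x = r.[x]) -> r.[z] = g z.
  move=> Cg z uz zv gr.
  have cg := Ck_cvg (nA z uz zv) Cg.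
  have cr : r.[x] @[x --> z^'] --> r.[z].
    apply: cvg_trans (@continuous_horner _ r z).
    by apply: cvg_app; exact: nbhs_dnbhs.
  case: gr => gr.
    apply: (@cvg_unique R (@norm_hausdorff R R) (r.[x] @[x --> z^'-])).
      exact: cvg_dnbhs_at_left.
    apply: cvg_trans (cvg_dnbhs_at_left cg); apply: near_eq_cvg.
    have h1 := nbhs_left_gt uz; have h2 := nbhs_left_lt z.
    by near=> x; apply: gr; [exact: (near h1 x)|exact: (near h2 x)].
  apply: (@cvg_unique R (@norm_hausdorff R R) (r.[x] @[x --> z^'+])).
    exact: cvg_dnbhs_at_right.
  apply: cvg_trans (cvg_dnbhs_at_right cg); apply: near_eq_cvg.
  have h1 := nbhs_right_lt zv; have h2 := nbhs_right_gt z.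
  by near=> x; apply: gr; [exact: (near h2 x)|exact: (near h1 x)].
elim: k f p q => [|k IH] f p q Cf fp fq.
  move=> j; rewrite leqn0 => /eqP ->; rewrite !derivn0.
  by rewrite (limit_value _ _ p Cf y) ?(limit_value _ _ q Cf y) //; [right|left].
case=> [|j] jk.
  rewrite !derivn0.
  by rewrite (limit_value _ _ p Cf y) ?(limit_value _ _ q Cf y) //; [right|left].
case: Cf => f' df Cf'.
(* [Ck] only asserts that some [f'] exists; uniqueness of limits identifies its values. *)
have deriv_value r x : u < x -> x < v -> (\forall z \near x, f z = r.[z]) ->
    f' x = r^`().[x].
  move=> ux xv fr.
  have dfx := has_deriv_dnbhs (nA x ux xv) (df x (uvA x ux xv)).
  apply: (@cvg_unique R (@norm_hausdorff R R) _ _ _ _ dfx).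
  exact: dnbhs_quotient_near_eq fr (@dnbhs_quotient_horner R r x).
rewrite !derivSn; apply: (IH f') => // x.
  move=> ux xy; apply: deriv_value => //; first exact: lt_trans xy yv.
  have h1 := lt_nbhsr ux; have h2 := lt_nbhsl xy.
  by near=> z; apply: fp; [exact: (near h1 z)|exact: (near h2 z)].
move=> yx xv; apply: deriv_value => //; first exact: lt_trans uy yx.
have h1 := lt_nbhsr yx; have h2 := lt_nbhsl xv.
by near=> z; apply: fq; [exact: (near h1 z)|exact: (near h2 z)].
Unshelve. all: by end_near. Qed.

(** * Taylor expansion and shifted powers of polynomials *)

(** Only the top term of the Taylor expansion at [y] survives. Applied to the difference of two
    adjacent pieces of a spline, this gives the form of the jump. *)
Lemma taylor_last (R : realType) k (r : {poly R}) (y : R) :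
  (size r <= k.+1)%N -> (forall j, (j < k)%N -> r^`(j).[y] = 0) ->
  exists a : R, forall x, r.[x] = a * (x - y) ^+ k.
Proof.
move=> sr r0; exists (r^`N(k).[y]) => x.
rewrite -[X in r.[X]](subrKC y) (nderiv_taylor_wide (mulrC _ _) sr).
rewrite big_ord_recr /= big1 ?add0r // => i _.
have := nderivn_def i r => /(congr1 (fun q : {poly R} => q.[y])).
rewrite r0 // hornerMn => /esym/eqP; rewrite mulrn_eq0 eqn0Ngt fact_gt0 /=.
by move=> /eqP ->; rewrite mul0r.
Qed.

(** The coefficient of $x^{k-l}$ on the right is $(-1)^l \binom{k}{l} \sum_j a_j y_j^l$. Comparing
    coefficients thus prescribes the moments of [a], a Vandermonde system that is invertible because
    the nodes are distinct. *)
Lemma shifted_powers_span (R : realType) k (y : 'I_k.+1 -> R) (p : {poly R}) :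
  injective y -> (size p <= k.+1)%N ->
  exists a : 'I_k.+1 -> R, forall x, p.[x] = \sum_j a j * (x - y j) ^+ k.
Proof.
move=> y_inj sp; pose V := Vandermonde k.+1 (\row_j y j).
have unitV : V \in unitmx.
  rewrite unitmxE unitfE det_Vandermonde; apply/prodf_neq0 => i _.
  apply/prodf_neq0 => j ij; rewrite !mxE subr_eq0 (inj_eq y_inj).
  by apply: contraTneq ij => ->; rewrite ltnn.
pose e : 'cV[R]_k.+1 := \col_l ((-1) ^+ l * p`_(k - l) / 'C(k, l)%:R).
pose a := invmx V *m e; exists (fun j => a j 0) => x.
have moments (l : 'I_k.+1) :
    \sum_j a j 0 * y j ^+ l = (-1) ^+ l * p`_(k - l) / 'C(k, l)%:R.
  have := congr1 (fun M : 'cV_k.+1 => M l 0) (mulKVmx unitV e).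
  rewrite !mxE => <-; apply: eq_bigr => j _.
  by rewrite -/a [V l j]mxE [(\row_i y i) 0 j]mxE mulrC.
(* Reversing the sum pairs the coefficient of index [k - i] with the [i]-th binomial term. *)
rewrite (horner_coef_wide x sp) (reindex_inj rev_ord_inj) /=.
under [RHS]eq_bigr => j _.
  rewrite exprBn mulr_sumr.
  under eq_bigr => i _.
    rewrite (_ : _ * _ = (-1) ^+ i * x ^+ (k - i) * 'C(k, i)%:R * (a j 0 * y j ^+ i)).
    over.
    by rewrite -mulr_natr; ring.
  over.
rewrite exchange_big /=; apply: eq_bigr => i _.
rewrite -mulr_sumr moments subSS.
have bin0 : 'C(k, i)%:R != 0 :> R by rewrite pnatr_eq0 -lt0n bin_gt0 -ltnS.
have sign : (-1) ^+ i * (-1) ^+ i = 1 :> R by rewrite -exprMn mulrNN mulr1 expr1n.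
transitivity ((-1) ^+ i * (-1) ^+ i * p`_(k - i) * x ^+ (k - i)).
  by rewrite sign mul1r.
by field.
Qed.

(** * Linear subspaces and the identification of functions *)

Section Subspaces.
Variable R : realType.
Implicit Types (F : set (R -> R)) (f g : R -> R) (A : set R).

Definition is_subspace F : Prop :=
  F (fun=> 0) /\ forall a f g, F f -> F g -> F (fun x => a * f x + g x).

Lemma subspace_sum F (I : Type) (r : seq I) (P : pred I) (a : I -> R) (v : I -> R -> R) :
  is_subspace F -> (forall i, P i -> F (v i)) ->
  F (fun x => \sum_(i <- r | P i) a i * v i x).
Proof.
move=> [F0 FDZ] Fv; elim: r => [|i r IH].
  by rewrite (_ : (fun x => _) = fun=> 0) //; apply/funext => x; rewrite big_nil.
have [Pi|Pi] := boolP (P i).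
  rewrite (_ : (fun x => _) =
    fun x => a i * v i x + \sum_(i <- r | P i) a i * v i x); last first.
    by apply/funext => x; rewrite big_cons Pi.
  by apply: FDZ => //; exact: Fv.
rewrite (_ : (fun x => _) = fun x => \sum_(i <- r | P i) a i * v i x) //.
by apply/funext => x; rewrite big_cons (negbTE Pi).
Qed.

Lemma lin_span_subspace F : is_subspace (lin_span F).
Proof.
split.
  exists 0%N, (fun=> 0), (fun=> fun=> 0); split; first by case.
  by apply/funext => x; rewrite big_ord0.
move=> b _ _ [n1 [a1 [v1 [Fv1 ->]]]] [n2 [a2 [v2 [Fv2 ->]]]].
exists (n1 + n2)%N,
  (fun i : 'I_(n1 + n2) => match fintype.split i with inl j => b * a1 j | inr j => a2 j end),
  (fun i : 'I_(n1 + n2) => match fintype.split i with inl j => v1 j | inr j => v2 j end); split.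
  by move=> i; case: splitP => j _.
apply/funext => x; rewrite big_split_ord mulr_sumr; congr (_ + _).
  apply: eq_bigr => i _; rewrite (unsplitK (inl i)) mulrA //.
by apply: eq_bigr => i _; rewrite (unsplitK (inr i)).
Qed.

Lemma sub_lin_span F : F `<=` lin_span F.
Proof.
move=> f Ff; exists 1%N, (fun=> 1), (fun=> f); split=> //.
by apply/funext => x; rewrite big_ord1 mul1r.
Qed.

Lemma lin_span_min F G : is_subspace G -> F `<=` G -> lin_span F `<=` G.
Proof.
move=> sG FG _ [n [a [v [Fv ->]]]]; apply: subspace_sum => // i _; exact: FG.
Qed.

Lemma same_on_eq m A f g : (forall x, A x -> f x = g x) -> same_on m A f g.
Proof.
move=> fg; rewrite /same_on; case: ifP => // _.
rewrite (_ : [set _ | _] = set0) //.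
by rewrite -subset0 => x [/fg ? ?].
Qed.

(** [s] lists the exceptional points, which are tolerated only for [m = 1]. *)
Lemma same_on_except m A f g (s : seq R) :
  (forall x, A x -> m = 1%N -> x \in s \/ f x = g x) ->
  (forall x, A x -> m <> 1%N -> f x = g x) -> same_on m A f g.
Proof.
move=> fg1 fg; rewrite /same_on; case: ifPn => [/eqP m1|/eqP m1 x Ax]; last exact: fg.
apply: sub_finite_set (finite_seq s) => x [Ax nfg].
by case: (fg1 x Ax m1).
Qed.

Lemma same_on_trans m A f g h : same_on m A f g -> same_on m A g h -> same_on m A f h.
Proof.
rewrite /same_on; case: ifP => _ fg gh; last by move=> x Ax; rewrite fg ?gh.
have : finite_set ([set x | A x /\ f x <> g x] `|` [set x | A x /\ g x <> h x]).
  by rewrite finite_setU.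
apply: sub_finite_set => x [Ax fh]; have [fgx|fgx] := eqVneq (f x) (g x).
  by right; split=> //; rewrite -fgx.
by left; split=> //; exact/eqP.
Qed.

Lemma same_onDZ m A a f1 f2 g1 g2 : same_on m A f1 f2 -> same_on m A g1 g2 ->
  same_on m A (fun x => a * f1 x + g1 x) (fun x => a * f2 x + g2 x).
Proof.
rewrite /same_on; case: ifP => _ ef eg; last by move=> x Ax; rewrite ef ?eg.
have : finite_set ([set x | A x /\ f1 x <> f2 x] `|` [set x | A x /\ g1 x <> g2 x]).
  by rewrite finite_setU.
apply: sub_finite_set => x [Ax ne]; have [e|e] := eqVneq (f1 x) (f2 x).
  by right; split=> // eg'; apply: ne; rewrite e eg'.
by left; split=> //; exact/eqP.
Qed.

Lemma sub_classes_on m c d F : F `<=` classes_on m c d F.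
Proof. by move=> f Ff; exists f => //; exact: same_on_eq. Qed.

Lemma classes_on_same m c d F f g : same_on m [set` `[c, d]] f g ->
  classes_on m c d F g -> classes_on m c d F f.
Proof. by move=> fg [h Fh gh]; exists h => //; exact: same_on_trans gh. Qed.

Lemma classes_on_sub m c d F G : F `<=` classes_on m c d G ->
  classes_on m c d F `<=` classes_on m c d G.
Proof. by move=> FG f [g /FG Gg fg]; exact: classes_on_same Gg. Qed.

Lemma classes_on_subspace m c d F :
  is_subspace F -> is_subspace (classes_on m c d F).
Proof.
move=> [F0 FDZ]; split; first exact: sub_classes_on.
move=> a f g [f' Ff' ff'] [g' Fg' gg'].
by exists (fun x => a * f' x + g' x); [exact: FDZ|exact: same_onDZ].
Qed.

Lemma spline_space_subspace m c d (xs : seq R) :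
  is_subspace (spline_space m c d xs).
Proof.
split.
  split=> [_|i _]; first exact: Ck_cst0.
  by exists 0; [rewrite size_poly0|move=> x _; rewrite horner0].
move=> a f g [Cf Pf] [Cg Pg]; split=> [m2|i ix].
  by apply: CkDZ; [exact: Cf|exact: Cg].
have [p sp fp] := Pf i ix; have [q sq gq] := Pg i ix.
exists (a *: p + q); last by move=> x cx; rewrite !hornerE fp // gq.
rewrite (leq_trans (size_polyD _ _)) // geq_max sq andbT.
exact: leq_trans (size_scale_leq _ _) sp.
Qed.

End Subspaces.

Lemma pos_pow_eq0 (R : realType) (z : R) k : z <= 0 -> pos_pow z k = 0.
Proof. by move=> z0; rewrite /pos_pow ltNge z0. Qed.

Lemma pos_pow_exprn (R : realType) (z : R) k :
  0 <= z -> (k = 0%N -> z != 0) -> pos_pow z k = z ^+ k.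
Proof.
rewrite le_eqVlt => /predU1P[<- k0|z0 _]; last by rewrite /pos_pow z0.
rewrite /pos_pow ltxx; case: k k0 => [/(_ erefl)|k _]; first by rewrite eqxx.
by rewrite expr0n.
Qed.

Lemma truncn_quotient (R : realType) (h s t : R) :
  0 < h -> s <= t -> (t - s) / h \is a Num.int ->
  t = s + (Num.truncn ((t - s) / h))%:R * h.
Proof.
move=> h0 st hint; rewrite truncnK; last first.
  by rewrite natrEint hint divr_ge0 ?subr_ge0 // ltW.
by rewrite divfK ?subrKC // gt_eqF.
Qed.

(** * Splines on a uniform grid *)

Section UniformGrid.
Variables (R : realType) (c h : R) (n : nat).
Hypothesis h_gt0 : 0 < h.

Let y i : R := c + i%:R * h.
Let xs : seq R := [seq y i | i <- iota 0 n.+1].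

Lemma knot_le i j : (y i <= y j) = (i <= j)%N.
Proof. by rewrite lerD2l ler_pM2r // ler_nat. Qed.

Lemma knot_lt i j : (y i < y j) = (i < j)%N.
Proof. by rewrite ltrD2l ltr_pM2r // ltr_nat. Qed.

Lemma size_knots : size xs = n.+1.
Proof. by rewrite size_map size_iota. Qed.

Lemma nth_knots i : (i <= n)%N -> nth 0 xs i = y i.
Proof.
by move=> ni; rewrite (nth_map 0%N) ?size_iota // nth_iota.
Qed.

Lemma mem_knots i : (i <= n)%N -> y i \in xs.
Proof. by move=> ni; apply: map_f; rewrite mem_iota. Qed.

(** Treats the half-open cells and the closed last one together: strictness on the right is asked
    only if another cell follows. *)
Lemma cell_knotsP i x : (i < n)%N ->
  cell xs i x <-> y i <= x <= y i.+1 /\ ((i.+1 < n)%N -> x < y i.+1).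
Proof.
move=> ni; rewrite /cell size_knots ltnS !nth_knots ?(ltnW ni) //.
case: ifPn => i1; rewrite /= in_itv /=; split.
- by move=> /andP[-> xy]; rewrite (ltW xy).
- by move=> [/andP[-> _] ->].
- by move=> ->.
- by case.
Qed.

(** The index is the integer part of [(x - c) / h], except at the right endpoint, which belongs to
    the last cell. *)
Lemma cell_cover x : (0 < n)%N -> c <= x <= y n ->
  exists2 i, (i < n)%N & cell xs i x.
Proof.
move=> n0 /andP[cx]; rewrite le_eqVlt => /predU1P[->|xd].
  exists n.-1; first by rewrite prednK.
  apply/cell_knotsP; rewrite prednK // ltnn; split=> //.
  by rewrite !knot_le leq_pred leqnn.
have q0 : 0 <= (x - c) / h by rewrite divr_ge0 ?subr_ge0 // ltW.
have /andP[il ir] := truncn_itv q0.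
have yx : y (Num.truncn ((x - c) / h)) <= x by rewrite -lerBrDl -ler_pdivlMr.
have xy : x < y (Num.truncn ((x - c) / h)).+1 by rewrite -ltrBlDl -ltr_pdivrMr.
have ni : (Num.truncn ((x - c) / h) < n)%N by rewrite -knot_lt (le_lt_trans yx).
exists (Num.truncn ((x - c) / h)) => //.
by apply/cell_knotsP => //; rewrite yx ltW.
Qed.

(** The hypothesis keeps [a] out of the interior of every cell, so each cell sees either the full
    power or 0. *)
Lemma pos_pow_in_splines m (a : R) : (0 < m)%N ->
  (forall i, (i < n)%N -> a <= y i \/ y i.+1 <= a) ->
  classes_on m c (y n) (spline_space m c (y n) xs) (fun x => pos_pow (x - a) m.-1).
Proof.
move=> m0 ay; have [da|ad] := lerP (y n) a.
  have [S0 _] := spline_space_subspace m c (y n) xs.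
  apply: (@classes_on_same R m c (y n) _ _ (fun=> 0)); last exact: sub_classes_on.
  apply: same_on_eq => x /=.
  by rewrite in_itv /= => /andP[_ xd]; rewrite pos_pow_eq0 // subr_le0 (le_trans xd).
(* For [m = 1] this is right-continuous at [a], as the cells require, while
   [pos_pow] takes the value 0 there. *)
pose g x := if a <= x then (x - a) ^+ m.-1 else 0.
exists g; last first.
  apply: (@same_on_except _ _ _ _ _ [:: a]) => x _ m1.
    have [->|xa] := eqVneq x a; first by left; rewrite inE.
    right; rewrite /g; case: lerP => ax; last by rewrite pos_pow_eq0 // subr_le0 ltW.
    by rewrite pos_pow_exprn ?subr_ge0 // subr_eq0.
  rewrite /g; case: lerP => ax.
    by rewrite pos_pow_exprn ?subr_ge0 // => ?; exfalso; lia.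
  by rewrite pos_pow_eq0 // subr_le0 ltW.
split=> [m2|i].
  rewrite (_ : g = fun x => pos_pow (x - a) (m - 2).+1); first exact: Ck_pos_pow.
  apply/funext => x; rewrite (_ : (m - 2).+1 = m.-1); last by lia.
  rewrite /g; case: lerP => ax; last by rewrite pos_pow_eq0 // subr_le0 ltW.
  by rewrite pos_pow_exprn ?subr_ge0 // => ?; exfalso; lia.
rewrite size_knots ltnS => ni; have [ayi|yia] := ay i ni.
  exists (('X - a%:P) ^+ m.-1); first by rewrite size_exp_XsubC prednK.
  move=> x /(cell_knotsP x ni)[/andP[yx _] _].
  by rewrite /g (le_trans ayi yx) horner_exp hornerXsubC.
exists 0; first by rewrite size_poly0.
move=> x /(cell_knotsP x ni)[_ xy]; rewrite horner0 /g leNgt.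
(* If this were the last cell, [y n <= a] would follow. So the cell is half-open and its points lie
   strictly below [a]. *)
have i1 : (i.+1 < n)%N.
  rewrite ltn_neqAle ni andbT; apply: contraTneq ad => <-.
  by rewrite -leNgt.
by rewrite (lt_le_trans (xy i1) yia).
Qed.

(** [p] is the first piece and [a l] the jump coefficient at [y l]; summing the jumps telescopes to
    every later piece. *)
Lemma spline_truncated_powers m f : (0 < m)%N -> (0 < n)%N ->
  spline_space m c (y n) xs f ->
  exists (p : {poly R}) (a : nat -> R), (size p <= m)%N /\
    same_on m [set` `[c, y n]] f
      (fun x => p.[x] + \sum_(1 <= l < n) a l * pos_pow (x - y l) m.-1).
Proof.
move=> m0 n0 [Cf Pf].
have /choice[p pP] : forall i, exists p : {poly R}, (i < n)%N ->
    (size p <= m)%N /\ forall x, cell xs i x -> f x = p.[x].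
  move=> i; have [ni|ni] := ltnP i n; last by exists 0.
  have [|p sp fp] := Pf i; first by rewrite size_knots.
  by exists p.
have on_piece i x : (i < n)%N -> y i <= x -> x < y i.+1 -> f x = (p i).[x].
  move=> ni yx xy.
  by apply: (pP i ni).2; apply/cell_knotsP => //; rewrite yx ltW.
have /choice[a aP] : forall l, exists a : R, (0 < l < n)%N ->
    forall x, (p l).[x] = (p l.-1).[x] + a * (x - y l) ^+ m.-1.
  case=> [|l]; first by exists 0; rewrite ltnn.
  have [l1|l1] := ltnP l.+1 n; last by exists 0; rewrite andbF.
  have sr : (size (p l.+1 - p l)%R <= m.-1.+1)%N.
    rewrite prednK // (leq_trans (size_polyD _ _)) // size_polyN geq_max.
    by rewrite (pP l.+1 l1).1 (pP l (ltnW l1)).1.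
  have [|a ra] := taylor_last (y := y l.+1) sr.
    move=> j jm; rewrite derivnB hornerD hornerN.
    (* The bound [j < m.-1] forces [m] to be at least 2, so smoothness is available; for [m = 1]
       there is nothing to match. *)
    have m2 : (1 < m)%N by lia.
    rewrite (@Ck_jump _ (m - 2) _ f (p l) (p l.+1) (y l) (y l.+1) (y l.+2) _ _ _ (Cf m2)).
    - by rewrite subrr.
    - by rewrite knot_lt.
    - by rewrite knot_lt.
    - move=> x lx xl /=; rewrite in_itv /= (le_trans _ (ltW lx)); last first.
        by rewrite -[c]addr0 -(mul0r h) (knot_le 0).
      by rewrite (le_trans (ltW xl)) // knot_le.
    - by move=> x lx xl; apply: on_piece => //; [exact: ltnW|exact: ltW].
    - by move=> x lx xl; apply: on_piece => //; exact: ltW.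
    - lia.
  by exists a => _ x; rewrite /= -ra hornerD hornerN subrKC.
exists (p 0%N), a; split; first by have [] := pP _ n0.
have pE i x : (i < n)%N ->
    (p i).[x] = (p 0%N).[x] + \sum_(1 <= l < i.+1) a l * (x - y l) ^+ m.-1.
  elim: i => [|i IH] ni; first by rewrite big_geq ?addr0.
  by rewrite big_nat_recr //= addrA -IH ?(ltnW ni) // (aP i.+1).
(* Knots are excluded for [m = 1], since [pos_pow 0 0] is 0 whereas the zeroth power of 0 is 1. *)
have main x : c <= x <= y n -> (m = 1%N -> x \notin xs) ->
    f x = (p 0%N).[x] + \sum_(1 <= l < n) a l * pos_pow (x - y l) m.-1.
  move=> cx mx; have [i ni ix] := cell_cover n0 cx.
  rewrite (pP i ni).2 // pE // (@big_cat_nat _ _ _ i.+1 1 n) //=.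
  have /(cell_knotsP x ni)[/andP[yx xy] _] := ix.
  (* Knots to the right of cell [i] contribute nothing at [x]. *)
  rewrite [X in _ = _ + (_ + X)]big_nat_cond [X in _ = _ + (_ + X)]big1 ?addr0; last first.
    move=> l /andP[/andP[il _] _].
    by rewrite pos_pow_eq0 ?mulr0 // subr_le0 (le_trans xy) // knot_le.
  congr (_ + _); apply: eq_big_nat => l /andP[_ li].
  rewrite pos_pow_exprn ?subr_ge0 ?(le_trans _ yx) ?knot_le //.
  move=> m1; rewrite subr_eq0; apply: contraNneq (mx _) => [->|]; last by lia.
  by rewrite mem_knots //; lia.
apply: (@same_on_except _ _ _ _ _ xs) => x /=; rewrite in_itv /= => cx m1.
  have [?|xxs] := boolP (x \in xs); first by left.
  by right; apply: main.
by apply: main.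
Qed.

End UniformGrid.

(** * Shifted B-splines and the equality of the two spaces *)

Lemma phi_shift (R : realType) m (b k x : R) : 0 < b ->
  phi m b (x - k) = b^-1 * m`!%:R^-1 * b^-1 ^+ m.-1 *
    \sum_(0 <= i < m.+1)
      (-1) ^+ i * 'C(m, i)%:R * pos_pow (x - (k + i%:R * b)) m.-1.
Proof.
move=> b0; rewrite /phi /Bspline -!mulrA; congr (_ * (_ * _)).
rewrite mulr_sumr; apply: eq_bigr => i _.
rewrite (_ : (x - k) / b - i%:R = b^-1 * (x - (k + i%:R * b))); last first.
  by field; rewrite gt_eqF.
by rewrite pos_powMl ?invr_gt0 // mulrCA !mulrA.
Qed.

(** Isolates the leading truncated power of a dictionary element once the other terms are known to
    lie in the span. *)
Lemma is_subspace_cancel (R : realType) (F : set (R -> R)) (a : R) (f g : R -> R) :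
  a != 0 -> is_subspace F -> F (fun x => a * (f x + g x)) -> F g -> F f.
Proof.
move=> a0 [F0 FDZ] Ffg Fg.
have Fng : F (fun x => - 1 * g x + 0) by apply: FDZ.
have := FDZ a^-1 _ _ Ffg Fng.
rewrite (_ : (fun x => _) = f) //; apply/funext => x.
by rewrite mulKf // mulN1r addr0 addrK.
Qed.

Theorem theorem1 (R : realType) (m : nat) (c d b b' : R)
  (hm : (1 <= m)%N) (hcd : c < d) (hb : 0 < b) (hb' : 0 < b')
  (hbint : (d - c) / b \is a Num.int)
  (hb'int : (d - c) / b' \is a Num.int)
  (hmb : m%:R * b <= d - c)
  (hpart : is_partition c d (grid b c d))
  (hpart' : is_partition c d (grid b' c d))
  (hsub : {subset grid b c d <= grid b' c d}) :
  classes_on m c d (lin_span (dictionary m c d b b')) =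
  classes_on m c d (spline_space m c d (grid b' c d)).
Proof.
(* The coarse knot [c + b] exists because the partition has at least three points; it lies on the
   fine grid, hence equals [c + q%:R * b']. *)
have [q q0 bE] : exists2 q, (0 < q)%N & b = q%:R * b'.
  have : c + 1%:R * b \in grid b c d.
    have /and4P[+ _ _ _] := hpart; rewrite size_map size_iota => sz.
    by apply: (map_f (fun i => c + i%:R * b) (x := 1%N)); rewrite mem_iota; lia.
  move/hsub => /mapP[q _] /addrI; rewrite mul1r => bE; exists q => //.
  by rewrite lt0n; apply: contraTneq hb => q0; rewrite bE q0 mul0r ltxx.
have dE := truncn_quotient hb' (ltW hcd) hb'int.
move: hpart'; rewrite /grid; move: dE; set n := Num.truncn _ => dE.
move=> /and4P[+ _ _ _]; rewrite size_map size_iota => n2.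
have n0 : (0 < n)%N by lia.
(* The fine grid prolonged to the left by [m * q] steps: [c] has index [m * q], [d] has index
   [m * q + n], and adding [b] shifts the index by [q]. *)
pose y t := c - m%:R * b + t%:R * b'.
pose h t x := pos_pow (x - y t) m.-1.
have yE i : y (m * q + i)%N = c + i%:R * b'.
  by rewrite /y bE natrD natrM; ring.
have ymq : y (m * q)%N = c by rewrite -[(m * q)%N]addn0 yE mul0r addr0.
have y_le t s : (y t <= y s) = (t <= s)%N by rewrite lerD2l ler_pM2r // ler_nat.
have yd : y (m * q + n)%N = d by rewrite yE -dE.
have yb t i : y t + i%:R * b = y (t + i * q)%N.
  by rewrite /y bE natrD natrM; ring.
have open_gridE : open_grid b' (c - m%:R * b) d = [seq y t | t <- iota 1 (m * q + n).-1].
  rewrite /open_grid (_ : _ / b' = (m * q + n)%:R) ?natrK //.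
  by rewrite -yd /y; field; rewrite gt_eqF.
set D := dictionary _ _ _ _ _; set S := spline_space _ _ _ _.
have sD := lin_span_subspace D.
have sV := classes_on_subspace m c d sD.
have sS : is_subspace S := spline_space_subspace _ _ _ _.
have sW := classes_on_subspace m c d sS.
(* A point of the prolonged grid never lies strictly inside a cell, wherever it is relative to
   [[c, d]]. *)
have hW t : classes_on m c d S (h t).
  rewrite /S dE; apply: pos_pow_in_splines => // i _; rewrite -!yE !y_le.
  by have [?|?] := leqP t (m * q + i)%N; [left|right; lia].
pose C := b^-1 * m`!%:R^-1 * b^-1 ^+ m.-1.
have C0 : C != 0.
  have fact0 : m`!%:R != 0 :> R by rewrite pnatr_eq0 -lt0n fact_gt0.
  by rewrite !mulf_neq0 ?expf_neq0 ?invr_neq0 ?gt_eqF.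
have phiE t : (fun x => phi m b (x - y t)) =
    fun x => C * \sum_(0 <= i < m.+1) (-1) ^+ i * 'C(m, i)%:R * h (t + i * q)%N x.
  by apply/funext => x; rewrite phi_shift //; under eq_bigr do rewrite yb.
have DE t : (0 < t < m * q + n)%N -> D (fun x => phi m b (x - y t)).
  move=> t1; exists (y t) => //=; rewrite open_gridE; apply: map_f.
  by rewrite mem_iota; lia.
(* Downward induction on [t], with [r] bounding the distance to [m * q + n]. For [r = 0], [y t] is
   at least [d] and [h t] vanishes on [[c, d]]. *)
have hV r t : (0 < t)%N -> (m * q + n <= t + r)%N ->
    classes_on m c d (lin_span D) (h t).
  elim: r t => [|r IH] t t0; rewrite ?addn0 => tr.
    have [V0 _] := sV.
    apply: (@classes_on_same R m c d _ _ (fun=> 0)) => //.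
    apply: same_on_eq => x /=; rewrite in_itv /= => /andP[_ xd].
    by rewrite /h pos_pow_eq0 // subr_le0 (le_trans xd) // -yd y_le.
  have [tr'|tr'] := leqP (m * q + n) (t + r); first exact: IH.
  have : classes_on m c d (lin_span D) (fun x => phi m b (x - y t)).
    by apply: sub_classes_on; apply: sub_lin_span; apply: DE; lia.
  rewrite phiE.
  (* The term [i = 0] is [h t] with coefficient 1; the others have index at least [t + q], hence
     above [t], and fall to the induction hypothesis. *)
  under eq_fun do rewrite big_nat_recl // expr0 bin0 mul1r mul1r mul0n addn0.
  move/(is_subspace_cancel C0 sV); apply.
  apply: subspace_sum => // i _; apply: IH; first by lia.
  by rewrite -addnA mulSn; lia.
apply/seteqP; split; apply: classes_on_sub.
  apply: lin_span_min => // _ [k /= kD <-].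
  move: kD; rewrite open_gridE => /mapP[t _ ->].
  rewrite phiE; have [W0 WDZ] := sW.
  rewrite (_ : (fun x => _) = fun x => C *
    (\sum_(0 <= i < m.+1) (-1) ^+ i * 'C(m, i)%:R * h (t + i * q)%N x) + 0).
    by apply: WDZ => //; apply: subspace_sum.
  by apply/funext => x; rewrite addr0.
move=> f; rewrite /S dE => /(spline_truncated_powers hb' hm n0).
rewrite -dE => -[p [a [sp fp]]]; apply: classes_on_same fp _.
have [V0 VDZ] := sV.
(* The nodes [y (m * q - j)] with [j < m] are distinct and at most [c], so on [[c, d]] their powers
   agree with truncated powers, up to one point if [m = 1]. Their indices are at least 1, as [hV]
   requires. *)
have pV : classes_on m c d (lin_span D) (horner p).
  have y_inj : injective (fun j : 'I_m.-1.+1 => y (m * q - j)%N).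
    move=> i j /eqP; rewrite eq_le !y_le => /andP[ij ji]; apply/val_inj => /=.
    by have := ltn_ord i; have := ltn_ord j; nia.
  have [|e pe] := @shifted_powers_span _ m.-1 _ p y_inj; first by rewrite prednK.
  rewrite (_ : horner p = fun x => \sum_j e j * (x - y (m * q - j)%N) ^+ m.-1); last first.
    exact/funext.
  apply: (@subspace_sum _ _ _ _ _ e (fun j x => (x - y (m * q - j)%N) ^+ m.-1)) => // j _.
  apply: (@classes_on_same R m c d _ _ (h (m * q - j)%N)); last first.
    by apply: (hV (m * q + n)%N); have := ltn_ord j; nia.
  (* The exception is [m = 1] at [x = c], where the node is [c] itself and the truncated power is
     0. *)
  apply: (@same_on_except _ _ _ _ _ [:: c]) => x /=; rewrite in_itv /= => /andP[cx _] m1.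
    have [->|xc] := eqVneq x c; first by left; rewrite inE.
    right; rewrite /h pos_pow_exprn ?subr_ge0 ?(le_trans _ cx) -?ymq ?y_le ?leq_subr //.
    move=> _; rewrite subr_eq0; apply: contraNneq xc => xy.
    by rewrite eq_le cx andbT xy -ymq y_le leq_subr.
  rewrite /h pos_pow_exprn ?subr_ge0 ?(le_trans _ cx) -?ymq ?y_le ?leq_subr //.
  by move=> ?; exfalso; lia.
(* The [l]-th interior fine knot is [y (m * q + l)]; the factor 1 matches the closure law of
   [is_subspace]. *)
rewrite (_ : (fun x => _) = fun x => 1 * p.[x] +
    \sum_(1 <= l < n) a l * h (m * q + l)%N x); last first.
  by apply/funext => x; rewrite mul1r; congr (_ + _); apply: eq_bigr => l _; rewrite /h yE.
apply: VDZ => //; apply: subspace_sum => // l _.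
by apply: (hV (m * q + n)%N); nia.
Qed.
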